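(* For all integers $n\geq 1$, $$V_n=\sup_{\hat k_1,\ldots,\hat k_n\in\widehat{\mathcal S}_{n-1}}\int_{[0,1]^n}\prod_{i=1}^n\varepsilon\!\left(2^{\hat k_i(x_{-i})}x_i\right)\mathrm{d}\Lambda^n(x_1,\dots,x_n).$$
   Context: Levine's hat game with $n\ge 1$ players and $h\ge 1$ hats per player: for $1\le i\le n$ player $i$ receives a random stack $U_i=(U_i^{(1)},\dots,U_i^{(h)})\in\{0,1\}^h$ ($1$ = black, $0$ = white), all the $U_i^{(k)}$ being independent Bernoulli$(1/2)$ variables. Player $i$ sees the stacks of all other players but not their own. An $h$-strategy for one player is a function $k:(\{0,1\}^h)^{n-1}\to\{1,\dots,h\}$; $\mathcal S_{n-1,h}$ denotes the set of $h$-strategies (for $n=1$, $\mathcal S_{0,h}=\{1,\dots,h\}$, i.e. constants). Define $$V_{n,h}:=\sup_{k_1,\dots,k_n\in\mathcal S_{n-1,h}}\mathbb P\left(\forall\, 1\le i\le n,\ U_i^{(k_i(U_j,\,j\ne i))}=1\right),\qquad V_n:=\lim_{h\to\infty}V_{n,h},$$ where the limit exists because $h\mapsto V_{n,h}$ is monotone and bounded. $\widehat{\mathcal S}_m$ is the set of Lebesgue-measurable functions $[0,1[^m\to\mathbb N^*=\{1,2,3,\dots\}$ (for $m=0$: the positive integer constants). For real $x$, $\varepsilon(x):=\lfloor x\rfloor-2\lfloor x/2\rfloor\in\{0,1\}$. For $x=(x_1,\dots,x_n)$, $x_{-i}:=(x_1,\dots,x_{i-1},x_{i+1},\dots,x_n)$.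 $\Lambda^n$ is Lebesgue measure on $\mathbb R^n$; the integrand is defined on $[0,1[^n$, hence almost everywhere on $[0,1]^n$. *)

(* Defs.v *)
From HB Require Import structures.
From mathcomp Require Import all_boot all_order all_algebra.
From mathcomp Require Import all_classical all_reals all_analysis.

Set Implicit Arguments.
Unset Strict Implicit.
Unset Printing Implicit Defensive.

Import Order.TTheory GRing.Theory Num.Theory.
Import numFieldNormedType.Exports.

Local Open Scope classical_set_scope.
Local Open Scope ring_scope.

Section tuple_measure.
Context d (T : measurableType d) (R : realType).

Definition cons_pair (n : nat) (p : T * n.-tuple T) : n.+1.-tuple T :=
  [tuple of p.1 :: p.2].

Lemma measurable_cons_pair n : measurable_fun setT (@cons_pair n).
Proof. by apply: measurable_cons. Qed.

HB.instance Definition _ n :=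
  isMeasurableFun.Build _ _ _ _ (@cons_pair n) (@measurable_cons_pair n).

Variable mu : {sigma_finite_measure set T -> \bar R}.

Section cons_measure.
Variables (n : nat) (nu : {sigma_finite_measure set (n.-tuple T) -> \bar R}).

Definition cons_measure : set (n.+1.-tuple T) -> \bar R :=
  pushforward (mu \x nu)%E (@cons_pair n).

Let cons_measure0 : cons_measure set0 = 0%E.
Proof. exact: measure0. Qed.

Let cons_measure_ge0 A : (0 <= cons_measure A)%E.
Proof. exact: measure_ge0. Qed.

Let cons_measure_sigma_additive : semi_sigma_additive cons_measure.
Proof. exact: (@measure_semi_sigma_additive _ _ _ (pushforward _ _)). Qed.

HB.instance Definition _ := isMeasure.Build _ _ _ cons_measure
  cons_measure0 cons_measure_ge0 cons_measure_sigma_additive.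

Let cons_measure_sigma_finite : sigma_finite setT cons_measure.
Proof.
have /sigma_finiteP[F [TF ndF Foo]] := sigma_finiteT mu.
have /sigma_finiteP[G [TG ndG Goo]] := sigma_finiteT nu.
have FS k l : (k <= l)%N -> F k `<=` F l by move=> /ndF /subsetPset.
have GS k l : (k <= l)%N -> G k `<=` G l by move=> /ndG /subsetPset.
exists (fun k => [set t | F k (tnth t ord0)] `&`
                 [set t : n.+1.-tuple T | G k [tuple of behead t]]).
  apply/esym; rewrite -subTset => t _.
  have : [set: T] (tnth t ord0) by [].
  have : [set: n.-tuple T] [tuple of behead t] by [].
  rewrite TF TG => -[k _ Gkt] [l _ Flt]; exists (maxn k l) => //; split.
  - exact: (FS _ _ (leq_maxr k l)).
  - exact: (GS _ _ (leq_maxl k l)).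
move=> k; have [mF Fk] := Foo k; have [mG Gk] := Goo k; split.
  apply: measurableI.
    rewrite -[X in measurable X]setTI.
    exact: (@measurable_tnth _ T n.+1 ord0).
  by rewrite -[X in measurable X]setTI; exact: measurable_behead.
rewrite /cons_measure /pushforward (_ : _ @^-1` _ = F k `*` G k).
  by rewrite product_measure1E// lte_mul_pinfty// ge0_fin_numE.
apply/seteqP; split=> -[x t] /=; rewrite /cons_pair /=.
- by move=> [Fx]; rewrite (_ : [tuple of _] = t)//; exact/val_inj.
- by move=> [Fx Gt]; split=> //; rewrite (_ : [tuple of _] = t)//; exact/val_inj.
Qed.

HB.instance Definition _ := @Measure_isSigmaFinite.Build _ _ _
  cons_measure cons_measure_sigma_finite.

End cons_measure.

(* The product of n copies of mu; see tuple_measure_box. *)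
Fixpoint tuple_measure (n : nat) :
    {sigma_finite_measure set (n.-tuple T) -> \bar R} :=
  match n with
  | 0 => \d_([tuple] : 0.-tuple T)
  | n'.+1 => cons_measure (tuple_measure n')
  end.

Lemma tuple_measure_box n (A : 'I_n -> set T) :
  (forall i, measurable (A i)) ->
  tuple_measure n [set x | forall i, A i (tnth x i)] =
  (\prod_(i < n) mu (A i))%E.
Proof.
elim: n A => [|n IHn] A mA.
  rewrite big_ord0 /= /dirac indicE mem_set//; by move=> [].
rewrite big_ord_recl /= /cons_measure /pushforward.
pose B := [set x : n.-tuple T | forall i, A (lift ord0 i) (tnth x i)].
rewrite -/(tuple_measure n) (_ : _ @^-1` _ = A ord0 `*` B); last first.
  apply/seteqP; split=> -[x t] /=.
    move=> h; split; first exact: (h ord0).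
    by move=> i; have := h (lift ord0 i); rewrite tnthS.
  move=> [Ax Bt] i; case: (unliftP ord0 i) => [j ->|->//].
  by rewrite tnthS; exact: Bt.
have mB : measurable B.
  rewrite (_ : B = \bigcap_(i in [set: 'I_n])
    ((fun x : n.-tuple T => tnth x i) @^-1` A (lift ord0 i))).
    apply: fin_bigcap_measurable => // i _.
    by rewrite -[_ @^-1` _]setTI; exact: measurable_tnth.
  apply/seteqP; split=> x /=; first by move=> h i _; exact: h.
  by move=> h i; exact: h.
rewrite product_measure1E//; congr (_ * _)%E.
by rewrite -IHn.
Qed.

End tuple_measure.

Definition drop_coord (T : Type) (n : nat) (i : 'I_n) (x : n.-tuple T) :
    n.-1.-tuple T :=
  [tuple tnth x (lift i j) | j < n.-1].

Section hat_game.
Variable R : realType.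

(* The n * h hats are independent Bernoulli(1/2) variables (true = black):
   the stacks are drawn from the product law.  Stacks are indexed from 0. *)
Definition stacks_law (n h : nat) :
    {sigma_finite_measure set (n.-tuple (h.-tuple bool)) -> \bar R} :=
  tuple_measure (tuple_measure (bernoulli_prob (2^-1 : R)) h) n.

Definition hat_strategy (m h : nat) := m.-tuple (h.-tuple bool) -> 'I_h.

Definition all_black (n h : nat) (k : 'I_n -> hat_strategy n.-1 h) :
    set (n.-tuple (h.-tuple bool)) :=
  [set u | forall i, tnth (tnth u i) (k i (drop_coord i u)) = true].

(* Meaningful for 1 <= h only; for h = 0 < n there is no strategy and the
   value is -oo, which does not affect the limit below. *)
Definition hat_value_h (n h : nat) : \bar R :=
  ereal_sup [set stacks_law n h (all_black k) |
             k in [set: 'I_n -> hat_strategy n.-1 h]].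

Definition hat_value (n : nat) : \bar R := limn (hat_value_h n).

(* n.-tuple R with its Lebesgue sigma-algebra, i.e. the Caratheodory
   sigma-algebra of the outer measure induced by the n-fold product of the
   Borel-Lebesgue measure. *)
Definition lebesgue_space (n : nat) : measurableType _ :=
  caratheodory_type ((tuple_measure (@lebesgue_measure R) n)^*)%mu.

Definition lebesgue_measure_n (n : nat) :
    {measure set (lebesgue_space n) -> \bar R} :=
  @completed_measure_extension _ _ R (tuple_measure (@lebesgue_measure R) n).

Definition half_open_cube (m : nat) : set (lebesgue_space m) :=
  [set x : m.-tuple R | forall i, 0 <= tnth x i < 1].
Arguments half_open_cube : clear implicits.

Definition unit_cube (n : nat) : set (lebesgue_space n) :=
  [set x : n.-tuple R | forall i, 0 <= tnth x i <= 1].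
Arguments unit_cube : clear implicits.

(* Strategies are total functions; their values outside [0,1[^m are
   irrelevant. *)
Definition lebesgue_strategy (m : nat) : set (lebesgue_space m -> nat) :=
  [set k | measurable_fun (half_open_cube m) k /\
           forall x, half_open_cube m x -> (0 < k x)%N].

Definition parity_bit (x : R) : int := Num.floor x - 2 * Num.floor (x / 2).

(* Off [0,1[^n the integrand takes arbitrary values in {0, 1}, but
   [0,1]^n \ [0,1[^n is negligible. *)
Definition lebesgue_payoff (n : nat) (k : 'I_n -> lebesgue_space n.-1 -> nat) :
    \bar R :=
  (\int[lebesgue_measure_n n]_(x in unit_cube n)
    (\prod_(i < n)
       (parity_bit (2 ^+ k i (drop_coord i x) * tnth x i))%:~R)%:E)%E.

End hat_game.

(* Main.v *)
Require Import Defs.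
From mathcomp Require Import all_boot all_order all_algebra.
From mathcomp Require Import all_classical all_reals all_analysis.
From mathcomp Require Import measurable_realfun zify lra ring.

(** The binary digits of a uniform point of [0,1[ are independent fair coins, so
    the integral is the probability of winning a game with infinitely many hats:
    the stack of player i is the expansion of x_i, and hat k of this stack is
    the digit of weight 2^-k, that is, the parity of the integer part of
    2^k x_i. The theorem says that the games with h hats exhaust this game.

    A strategy for h hats is a strategy for infinitely many hats that looks at
    the first h digits only, and the first h digits are distributed like the
    stacks. Hence every value V_(n,h) is at most the supremum
    (stacks_law_all_black_le).

    Conversely, let k be strategies for infinitely many hats and fix h. Cut each
    coordinate x_i into its first h digits u_i and the remaining digits, which
    form a point t_i of [0,1[. For a uniform x, the families u and t are
    independent, u is distributed like the stacks and t is uniform on the cube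
    (lebesgue_cylinder_tuple). For a fixed t the strategies k depend on u only
    and, as long as they choose among the first h hats, they are strategies for
    h hats, which win with probability at most V_(n,h). Averaging over t
    (lebesgue_le_stacks_law), the payoff of k is at most V_(n,h) plus the
    probability that some player chooses a hat beyond the first h
    (lebesgue_payoff_le_hat_value). This probability tends to 0 when h grows,
    because all choices are finite (late_choice_cvg0). So the values V_(n,h) are
    bounded by the supremum and eventually exceed every number below it.

    The independence of u and t comes from the affine change of variables on the
    line and from the fact that a finite measure on tuples is determined by its
    values on boxes (tuple_measure_unique). As the strategies are only Lebesgue
    measurable, two more facts are needed: a Lebesgue measurable event on n - 1
    coordinates remains one when viewed on n coordinates
    (lebesgue_drop_coord_measurable), and a Lebesgue measurable event contains a
    Borel event of the same measure (caratheodory_sandwich). *)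

Set Implicit Arguments.
Unset Strict Implicit.
Unset Printing Implicit Defensive.

Import Order.TTheory GRing.Theory Num.Theory.
Import numFieldNormedType.Exports.

Local Open Scope classical_set_scope.
Local Open Scope ring_scope.

(** * Binary digits *)

(** Indexed from 0, like the hats of a stack: this is the digit of weight
    2 ^- j.+1 of x. *)
Definition binary_digit (R : realType) (j : nat) (x : R) : bool :=
  parity_bit (2 ^+ j.+1 * x) == 1.

Definition digits (R : realType) (h : nat) (x : R) : h.-tuple bool :=
  [tuple binary_digit j x | j < h].

(** The integer with binary expansion w 0 ... w (h - 1), most significant digit
    first. *)
Fixpoint word_num (w : nat -> bool) (h : nat) : int :=
  if h is h'.+1 then 2 * word_num w h' + (w h' : nat)%:Z else 0.

Lemma floor_eqP (R : realType) (x : R) (m : int) :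
  Num.floor x = m <-> m%:~R <= x < m%:~R + 1.
Proof.
split=> [<-|xm]; first by rewrite floor_le_tmp -intrD1 floorD1_gt.
by apply: floor_def; rewrite intrD1.
Qed.

(** Since 2 * floor (x / 2) <= x < 2 * floor (x / 2) + 2, the difference of the
    two integer parts can only be 0 or 1. *)
Lemma parity_bitP (R : realType) (x : R) :
  parity_bit x = (parity_bit x == 1 : nat)%:Z.
Proof.
have /floor_eqP := erefl (Num.floor (x / 2)).
have /floor_eqP := erefl (Num.floor x).
rewrite /parity_bit; set m := Num.floor x; set q := Num.floor _.
move=> /andP[mx xm] /andP[qx xq].
have q_le : 2 * q < m + 1 by rewrite -(ltr_int R) intrM intrD; lra.
have m_le : m < 2 * q + 2 by rewrite -(ltr_int R) intrD intrM; lra.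
clear -q_le m_le; clearbody m q.
have [->|->] : m - 2 * q = 0 \/ m - 2 * q = 1 by lia.
  by [].
by [].
Qed.

Lemma floor_pow2S (R : realType) (j : nat) (x : R) :
  Num.floor (2 ^+ j.+1 * x) =
  2 * Num.floor (2 ^+ j * x) + (binary_digit j x : nat)%:Z.
Proof.
rewrite /binary_digit -parity_bitP /parity_bit.
have -> : 2 ^+ j.+1 * x / 2 = 2 ^+ j * x by rewrite exprS; field.
by rewrite [RHS]addrC subrK.
Qed.

(** The integer part of 2 ^+ h * x and the first h digits of x carry the same
    information: by floor_pow2S each further digit b turns the integer part a
    into 2 * a + b, from which a and b can be recovered. *)
Lemma floor_pow2_word (R : realType) (w : nat -> bool) (h : nat) (x : R) :
  Num.floor (2 ^+ h * x) = word_num w h <->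
  0 <= x < 1 /\ forall j, (j < h)%N -> binary_digit j x = w j.
Proof.
elim: h => [|h IHh].
  rewrite expr0 mul1r /= floor_eqP add0r; split=> [x01|[]//].
  by split.
rewrite floor_pow2S /=.
have -> : (2 * Num.floor (2 ^+ h * x) + (binary_digit h x : nat)%:Z =
           2 * word_num w h + (w h : nat)%:Z) <->
          (Num.floor (2 ^+ h * x) = word_num w h /\ binary_digit h x = w h).
  split=> [|[-> ->]//].
  by case: (binary_digit h x); case: (w h) => /= e; split=> //; clear -e; lia.
rewrite IHh; split=> [[[x01 xw] xh]|[x01 xw]]; split => //.
- by move=> j; rewrite ltnS leq_eqVlt => /orP[/eqP->//|]; exact: xw.
- by split=> // j jh; apply: xw; rewrite ltnS ltnW.
- exact: xw.
Qed.

(** * Cylinders of the unit interval *)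

Lemma image_measure d d' (T : measurableType d) (T' : measurableType d')
    (R : realType) (m : {measure set T -> \bar R}) (f : T -> T') :
  measurable_fun setT f ->
  exists nu : {measure set T' -> \bar R}, forall A, nu A = m (f @^-1` A).
Proof. by move=> mf; unshelve eexists (pushforward m f). Qed.

(** Divided by a, the left-hand side is a measure in A that gives half-open
    intervals their length, and only Lebesgue measure does. *)
Lemma lebesgue_measure_affine (R : realType) (a c : R) (A : set R) :
  0 < a -> measurable A ->
  lebesgue_measure ((fun t => (c + t) / a) @^-1` A) =
  (a%:E * lebesgue_measure A)%E.
Proof.
move=> a0 mA; pose f (t : R) := (c + t) / a.
have mf : measurable_fun [set: measurableTypeR R] (f : _ -> measurableTypeR R).
  by apply: measurable_funM => //; apply: measurable_funD.
have inva_ge0 : 0 <= a^-1 by rewrite invr_ge0 ltW.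
have [nu0 nu0E] := image_measure (@lebesgue_measure R) mf.
pose nu : {measure set (measurableTypeR R) -> \bar R} :=
  mscale (NngNum inva_ge0) nu0.
have nuE X : nu X = (a^-1%:E * lebesgue_measure (f @^-1` X))%E.
  by rewrite -nu0E.
suff nuL X : ocitv X -> lebesgue_measure X = nu X.
  have -> : lebesgue_measure A = nu A := lebesgue_measure_unique nuL mA.
  by rewrite nuE muleA -EFinM divff ?gt_eqF// mul1e.
move=> [[x y] _ <-] /=; rewrite nuE.
have -> : f @^-1` `]x, y] = `](a * x - c), (a * y - c)]%classic.
  apply/seteqP; split=> t /=; rewrite !in_itv/= /f ltr_pdivlMr// ler_pdivrMr//;
  by move=> /andP[? ?]; apply/andP; split; lra.
rewrite !lebesgue_measure_itv/= !lte_fin ltrD2r ltr_pM2l//.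
case: ifPn => _; last by rewrite mule0.
by rewrite -!EFinD -EFinM; congr EFin; field; rewrite gt_eqF.
Qed.

(** Reads w before the digits of t, for t in [0,1[. *)
Definition prepend (R : realType) (h : nat) (w : h.-tuple bool) (t : R) : R :=
  ((word_num (nth false w) h)%:~R + t) / 2 ^+ h.

(** A dyadic interval of length 2 ^- h. *)
Definition cylinder (R : realType) (h : nat) (w : h.-tuple bool) : set R :=
  [set x | 0 <= x < 1 /\ digits h x = w].
Arguments cylinder R {h} w.

Lemma cylinder_floorP (R : realType) (h : nat) (w : h.-tuple bool) (x : R) :
  cylinder R w x <-> Num.floor (2 ^+ h * x) = word_num (nth false w) h.
Proof.
rewrite floor_pow2_word; split=> [[x01 <-]|[x01 xw]]; split=> //.
  move=> j jh; have :=
    tnth_mktuple (fun j : 'I_h => binary_digit j x) (Ordinal jh).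
  by rewrite (tnth_nth false).
by apply: eq_from_tnth => j; rewrite tnth_mktuple xw// (tnth_nth false).
Qed.

Lemma prepend_cylinderP (R : realType) (h : nat) (w : h.-tuple bool) (t : R) :
  cylinder R w (prepend w t) <-> 0 <= t < 1.
Proof.
rewrite cylinder_floorP floor_eqP /prepend mulrC divfK ?gt_eqF ?exprn_gt0//.
by split=> /andP[? ?]; apply/andP; split; lra.
Qed.

Lemma measurable_cylinder (R : realType) (h : nat) (w : h.-tuple bool) :
  measurable (cylinder R w).
Proof.
pose v : R := (word_num (nth false w) h)%:~R.
have p0 : 0 < 2 ^+ h :> R by rewrite exprn_gt0.
rewrite (_ : cylinder R w = `[v / 2 ^+ h, (v + 1) / 2 ^+ h[%classic).
  exact: measurable_itv.
apply/seteqP; split=> x; rewrite cylinder_floorP floor_eqP /= in_itv /=;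
  by rewrite ler_pdivrMr// ltr_pdivlMr// [x * _]mulrC.
Qed.

(** prepend w is affine with ratio 2 ^- h and maps [0,1[ onto the cylinder
    of w. *)
Lemma lebesgue_prepend (R : realType) (h : nat) (w : h.-tuple bool)
    (A : set R) : measurable A ->
  lebesgue_measure ([set t : R | 0 <= t < 1] `&` prepend w @^-1` A) =
  ((2 ^+ h)%:E * lebesgue_measure (A `&` cylinder R w))%E.
Proof.
move=> mA.
rewrite -(@lebesgue_measure_affine R _ (word_num (nth false w) h)%:~R).
- congr lebesgue_measure; apply/seteqP; split=> t /=.
    by move=> [/prepend_cylinderP - /(_ _ w) wt At].
  by move=> [At /prepend_cylinderP wt].
- by rewrite exprn_gt0.
- by apply: measurableI => //; exact: measurable_cylinder.
Qed.

(** * Measures on tuples *)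

Lemma measurable_box d (T : measurableType d) (n : nat) (A : 'I_n -> set T) :
  (forall i, measurable (A i)) ->
  measurable [set x : n.-tuple T | forall i, A i (tnth x i)].
Proof.
move=> mA; rewrite (_ : mkset _ = \bigcap_(i in [set: 'I_n])
    ((fun x : n.-tuple T => tnth x i) @^-1` A i)).
  apply: fin_bigcap_measurable => // i _.
  by rewrite -[_ @^-1` _]setTI; exact: measurable_tnth.
by apply/seteqP; split=> x /= h i; [move=> _; exact: h|exact: (h i)].
Qed.

(** Boxes are stable under intersection and generate the product
    sigma-algebra, so the pi-lambda theorem applies. This turns identities
    between image measures on tuples into one-dimensional computations. *)
Lemma tuple_measure_unique d (T : measurableType d) (R : realType) (n : nat)
    (m1 m2 : {measure set (n.-tuple T) -> \bar R}) :
  (m1 setT < +oo)%E ->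
  (forall A : 'I_n -> set T, (forall i, measurable (A i)) ->
    m1 [set x | forall i, A i (tnth x i)] =
    m2 [set x | forall i, A i (tnth x i)]) ->
  forall E, measurable E -> m1 E = m2 E.
Proof.
move=> m1oo m12 E mE.
pose boxes := [set B : set (n.-tuple T) | exists2 A : 'I_n -> set T,
  (forall i, measurable (A i)) & B = [set x | forall i, A i (tnth x i)]].
have boxesT : boxes setT by exists (fun=> setT) => //; apply/seteqP; split.
apply: (measure_unique boxes (fun=> setT)) => //.
- apply/seteqP; split; last first.
    apply: smallest_sub; first exact: sigma_algebra_measurable.
    by move=> _ [A mA ->]; exact: measurable_box.
  apply: smallest_sub; first exact: smallest_sigma_algebra.
  (* a generator constrains coordinate i only: the other sides are full *)
  move=> B; rewrite -bigcup_seq => -[i _ [C mC <-]]; rewrite setTI.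
  apply: sub_sigma_algebra.
  exists (fun j => if j == i then C else setT) => [j|]; first by case: ifP.
  apply/seteqP; split=> x /= => [Cx j|/(_ i)]; last by rewrite eqxx.
  by case: eqP => [->|].
- move=> _ _ [A mA ->] [B mB ->]; exists (fun i => A i `&` B i).
    by move=> i; exact: measurableI.
  apply/seteqP; split=> x /= => [[Ax Bx] i|ABx]; first by split.
  by split=> i; have [] := ABx i.
- by apply/seteqP; split => // x _; exists 0%N.
- by move=> _ [A mA ->]; exact: m12.
Qed.

(** * Uniform points of the cube *)

Local Notation lebesgue_product R n := (tuple_measure (@lebesgue_measure R) n).

Definition cube (R : realType) (n : nat) : set (n.-tuple (measurableTypeR R)) :=
  [set x | forall i, 0 <= tnth x i < 1].
Arguments cube : clear implicits.

Lemma measurable_unit_interval (R : realType) :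
  measurable [set t : measurableTypeR R | 0 <= t < 1].
Proof.
rewrite (_ : mkset _ = `[0, 1[%classic); first exact: measurable_itv.
by apply/seteqP; split=> t /=; rewrite in_itv.
Qed.
Arguments measurable_unit_interval : clear implicits.
#[local] Hint Resolve measurable_unit_interval : core.

Lemma lebesgue_unit_interval (R : realType) :
  lebesgue_measure [set t : R | 0 <= t < 1] = 1%E.
Proof.
rewrite (_ : mkset _ = `[0, 1[%classic).
  by rewrite lebesgue_measure_itv/= lte_fin ltr01 oppr0 adde0.
by apply/seteqP; split=> t /=; rewrite in_itv.
Qed.

Lemma measurable_cube (R : realType) (n : nat) : measurable (cube R n).
Proof.
apply: (measurable_box (A := fun=> [set t : measurableTypeR R | 0 <= t < 1])).
by move=> i; exact: measurable_unit_interval.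
Qed.
Arguments measurable_cube : clear implicits.
#[local] Hint Resolve measurable_cube : core.

Lemma lebesgue_cube (R : realType) (n : nat) :
  lebesgue_product R n (cube R n) = 1%E.
Proof.
have /= -> := @tuple_measure_box _ _ R lebesgue_measure n
  (fun=> [set t : measurableTypeR R | 0 <= t < 1])
  (fun=> measurable_unit_interval R).
by rewrite big1// => i _; exact: lebesgue_unit_interval.
Qed.

Lemma measurable_drop_coord d (T : measurableType d) (n : nat) (i : 'I_n) :
  measurable_fun setT (@drop_coord T n i).
Proof.
apply/measurable_fun_tnthP => j.
rewrite (_ : _ \o _ = fun x => tnth x (lift i j)); first exact: measurable_tnth.
by apply/funext => x /=; rewrite tnth_mktuple.
Qed.

(** Forgetting one coordinate of a uniform point of the cube leaves a uniform
    point: on boxes, the free coordinate contributes the factor 1. *)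
Lemma lebesgue_drop_coord (R : realType) (n : nat) (i : 'I_n)
    (E : set (n.-1.-tuple (measurableTypeR R))) : measurable E ->
  lebesgue_product R n (cube R n `&` drop_coord i @^-1` E) =
  lebesgue_product R n.-1 (cube R n.-1 `&` E).
Proof.
move=> mE.
have [nu nuE] := image_measure
  (mrestr (lebesgue_product R n) (measurable_cube R n))
  (measurable_drop_coord i).
pose m : {measure set _ -> \bar R} :=
  mrestr (lebesgue_product R n.-1) (measurable_cube R n.-1).
rewrite setIC -[LHS]nuE [in RHS]setIC -[RHS]/(m E).
apply: tuple_measure_unique mE => [|A mA].
  by rewrite nuE preimage_setT /= /mrestr setTI lebesgue_cube ltry.
rewrite nuE /m /= /mrestr.
pose B j : set (measurableTypeR R) := [set t | 0 <= t < 1] `&` A j.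
pose C k : set (measurableTypeR R) := [set t | 0 <= t < 1] `&`
  (if unlift i k is Some j then A j else setT).
rewrite [X in _ = tuple_measure _ _ X](_ : _ =
  [set x | forall j, B j (tnth x j)]); last first.
  apply/seteqP; split=> x /= => [[Ax x01] j|xA].
    by split; [exact: x01|exact: Ax].
  by split=> j; have [] := xA j.
rewrite [X in tuple_measure _ _ X = _](_ : _ =
  [set x | forall k, C k (tnth x k)]); last first.
  apply/seteqP; split=> x /= => [[Ax x01] k|xA].
    split; first exact: x01.
    by case: unliftP => // j ->; have := Ax j; rewrite tnth_mktuple.
  split=> [j|k]; last by have [] := xA k.
  by rewrite tnth_mktuple; have [_] := xA (lift i j); rewrite liftK.
rewrite !tuple_measure_box; last 2 first.
- by move=> j; apply: measurableI; [exact: measurable_unit_interval|exact: mA].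
- move=> k; apply: measurableI; first exact: measurable_unit_interval.
  by case: unlift => [j|]; [exact: mA|exact: measurableT].
rewrite (bigD1_ord i)//= /C unlift_none setIT lebesgue_unit_interval mul1e.
by apply: eq_bigr => j _; rewrite liftK.
Qed.

Definition prepend_tuple (R : realType) (n h : nat)
    (u : n.-tuple (h.-tuple bool)) (t : n.-tuple R) : n.-tuple R :=
  [tuple prepend (tnth u i) (tnth t i) | i < n].

Definition cylinder_tuple (R : realType) (n h : nat)
    (u : n.-tuple (h.-tuple bool)) : set (n.-tuple (measurableTypeR R)) :=
  [set x | forall i, cylinder R (tnth u i) (tnth x i)].
Arguments cylinder_tuple R {n h} u.

Lemma measurable_cylinder_tuple (R : realType) (n h : nat)
    (u : n.-tuple (h.-tuple bool)) : measurable (cylinder_tuple R u).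
Proof.
apply: (measurable_box (A := fun i => cylinder R (tnth u i))) => i.
exact: measurable_cylinder.
Qed.
Arguments measurable_cylinder_tuple R {n h} u.

Lemma measurable_prepend (R : realType) (h : nat) (w : h.-tuple bool) :
  measurable_fun [set: measurableTypeR R] (prepend w : _ -> measurableTypeR R).
Proof. by apply: measurable_funM => //; exact: measurable_funD. Qed.

Lemma measurable_prepend_tuple (R : realType) (n h : nat)
    (u : n.-tuple (h.-tuple bool)) :
  measurable_fun [set: n.-tuple (measurableTypeR R)]
    (prepend_tuple u : _ -> n.-tuple (measurableTypeR R)).
Proof.
apply/measurable_fun_tnthP => i.
rewrite (_ : _ \o _ = prepend (tnth u i) \o (fun x => tnth x i)).
  apply: measurableT_comp; [exact: measurable_prepend|exact: measurable_tnth].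
by apply/funext => x /=; rewrite tnth_mktuple.
Qed.

(** On boxes this is the product over the n coordinates of
    lebesgue_prepend. *)
Lemma lebesgue_prepend_tuple (R : realType) (n h : nat)
    (u : n.-tuple (h.-tuple bool)) (E : set (n.-tuple (measurableTypeR R))) :
  measurable E ->
  lebesgue_product R n (cube R n `&` prepend_tuple u @^-1` E) =
  (((2 ^+ h) ^+ n)%:E * lebesgue_product R n (cylinder_tuple R u `&` E))%E.
Proof.
move=> mE.
have [nu nuE] := image_measure
  (mrestr (lebesgue_product R n) (measurable_cube R n))
  (measurable_prepend_tuple u).
have p0 : 0 <= (2 ^+ h) ^+ n :> R by rewrite !exprn_ge0.
pose m : {measure set (n.-tuple (measurableTypeR R)) -> \bar R} :=
  mscale (NngNum p0)
    (mrestr (lebesgue_product R n) (measurable_cylinder_tuple R u)).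
rewrite setIC -[LHS]nuE [in RHS]setIC -[RHS]/(m E).
apply: tuple_measure_unique mE => [|A mA].
  by rewrite nuE preimage_setT /= /mrestr setTI lebesgue_cube ltry.
rewrite nuE /m /mscale/= /mrestr.
pose B j : set (measurableTypeR R) := A j `&` cylinder R (tnth u j).
pose C j : set (measurableTypeR R) :=
  [set t | 0 <= t < 1] `&` prepend (tnth u j) @^-1` A j.
rewrite [X in _ = (_ * tuple_measure _ _ X)%E](_ : _ =
  [set x | forall j, B j (tnth x j)]); last first.
  apply/seteqP; split=> x /= => [[Ax xu] j|xA].
    by split; [exact: Ax|exact: xu].
  by split=> j; have [] := xA j.
rewrite [X in tuple_measure _ _ X = _](_ : _ =
  [set x | forall j, C j (tnth x j)]); last first.
  apply/seteqP; split=> x /= => [[Ax x01] j|xA].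
    by split; [exact: x01|have := Ax j; rewrite tnth_mktuple].
  by split=> j; [rewrite tnth_mktuple|]; have [] := xA j.
rewrite !tuple_measure_box; last 2 first.
- by move=> j; apply: measurableI; [exact: mA|exact: measurable_cylinder].
- move=> j; apply: measurableI; first exact: measurable_unit_interval.
  by rewrite -[_ @^-1` _]setTI; exact: measurable_prepend.
rewrite (eq_bigr (fun j => (2 ^+ h)%:E * lebesgue_measure (B j))%E); last first.
  by move=> j _; exact: lebesgue_prepend (mA j).
rewrite big_split/= prodEFin; congr (_%:E * _)%E.
by rewrite prodr_const card_ord.
Qed.

(** * The law of the stacks is the law of the first digits *)

Lemma measure_fibers d (T : measurableType d) (R : realType)
    (mu : {measure set T -> \bar R}) (I : finType) (f : T -> I) (D : set T) :
  (forall i, measurable (D `&` f @^-1` [set i])) ->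
  mu D = (\sum_i mu (D `&` f @^-1` [set i]))%E.
Proof.
move=> mDf.
rewrite bigfs ?index_enum_uniq// => [|i _]; last by rewrite mem_index_enum.
rewrite -measure_fin_bigcup//.
- congr (mu _); apply/seteqP; split=> x /= => [Dx|[i _ []]//].
  by exists (f x).
- apply/trivIsetP => i j _ _ ij; apply/seteqP; split=> x //= -[[_ ->] [_ /eqP]].
  by rewrite (negbTE ij).
Qed.

Lemma tuple_set1 (T : Type) (n : nat) (u : n.-tuple T) :
  [set u] = [set v | forall i, [set tnth u i] (tnth v i)].
Proof.
apply/seteqP; split=> v /= => [-> //|uv].
by apply: eq_from_tnth => i; rewrite uv.
Qed.

Lemma measurable_tuple_set1 d (T : measurableType d) (n : nat) :
  (forall a : T, measurable [set a]) ->
  forall u : n.-tuple T, measurable [set u].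
Proof.
move=> mT u; rewrite tuple_set1.
by apply: (measurable_box (A := fun i => [set tnth u i])).
Qed.

Lemma tuple_measure_set1 d (T : measurableType d) (R : realType)
    (mu : {sigma_finite_measure set T -> \bar R}) (n : nat) (c : R) :
  (forall a : T, measurable [set a]) -> (forall a, mu [set a] = c%:E) ->
  forall u, tuple_measure mu n [set u] = (c ^+ n)%:E.
Proof.
move=> mT mu1 u; rewrite tuple_set1.
rewrite (tuple_measure_box _ (A := fun i => [set tnth u i]))//.
by rewrite (eq_bigr (fun=> c%:E))// prodEFin prodr_const card_ord.
Qed.

Lemma measurable_stacks (n h : nat) (A : set (n.-tuple (h.-tuple bool))) :
  measurable A.
Proof.
rewrite (_ : A = \bigcup_(u in A) [set u]); last first.
  by apply/seteqP; split=> [u Au|_ [u Au ->]//]; exists u.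
apply: fin_bigcup_measurable => // u _.
by apply: measurable_tuple_set1; exact: measurable_tuple_set1.
Qed.

Lemma stacks_law_set1 (R : realType) (n h : nat)
    (u : n.-tuple (h.-tuple bool)) :
  stacks_law R n h [set u] = (((2 ^+ h) ^+ n)^-1)%:E.
Proof.
rewrite -!exprVn; apply: tuple_measure_set1; first exact: measurable_tuple_set1.
move=> w; apply: tuple_measure_set1 => // b.
rewrite /= bernoulli_probE; last first.
  by rewrite invr_ge0 ler0n invf_le1 ?ler1n ?ltr0n.
rewrite /dirac !indicE !classical_sets.in_set1; case: b; rewrite /= mule0 mule1.
  by rewrite adde0.
by rewrite add0e /unstable.onem; congr EFin; lra.
Qed.

Definition digits_tuple (R : realType) (n h : nat) (x : n.-tuple R) :
    n.-tuple (h.-tuple bool) :=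
  [tuple digits h (tnth x i) | i < n].

Lemma cylinder_tupleE (R : realType) (n h : nat)
    (u : n.-tuple (h.-tuple bool)) :
  cylinder_tuple R u = cube R n `&` digits_tuple h @^-1` [set u].
Proof.
apply/seteqP; split=> x /= => [xu|[x01 <-] i].
  split=> [i|]; first by have [] := xu i.
  by apply: eq_from_tnth => i; rewrite tnth_mktuple; have [] := xu i.
by split; [exact: x01|rewrite tnth_mktuple].
Qed.

(** Independence of the digits and the tails: given that the first h digits of
    a uniform point are u, which has the probability that the stacks are u, the
    remaining digits form a uniform point again. *)
Lemma lebesgue_cylinder_tuple (R : realType) (n h : nat)
    (u : n.-tuple (h.-tuple bool)) (E : set (n.-tuple (measurableTypeR R))) :
  measurable E ->
  lebesgue_product R n (cylinder_tuple R u `&` E) =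
  (stacks_law R n h [set u] *
   lebesgue_product R n (cube R n `&` prepend_tuple u @^-1` E))%E.
Proof.
move=> mE; rewrite lebesgue_prepend_tuple// stacks_law_set1 muleA -EFinM.
by rewrite mulVf ?mul1e// !expf_neq0.
Qed.

(** The first h digits of the coordinates of a uniform point are distributed
    like the stacks: sum lebesgue_cylinder_tuple over the u in A. *)
Lemma lebesgue_digits_tuple (R : realType) (n h : nat)
    (A : set (n.-tuple (h.-tuple bool))) :
  measurable (cube R n `&` digits_tuple h @^-1` A) /\
  lebesgue_product R n (cube R n `&` digits_tuple h @^-1` A) =
  stacks_law R n h A.
Proof.
pose D := cube R n `&` digits_tuple h @^-1` A.
have cA u : D `&` digits_tuple h @^-1` [set u] =
    if u \in A then cylinder_tuple R u else set0.
  case: ifPn => [/set_mem Au|/negP nAu].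
    rewrite cylinder_tupleE /D; apply/seteqP; split=> x /= [].
      by case=> ? _ ?.
    by move=> x01 xu; rewrite xu.
  apply/seteqP; split=> x //= [[_ Ax] xu]; apply: nAu.
  by rewrite -xu; exact: mem_set.
have mcA u : measurable (D `&` digits_tuple h @^-1` [set u]).
  by rewrite cA; case: ifP => // _; exact: measurable_cylinder_tuple.
split.
  rewrite (_ : _ `&` _ = \bigcup_(u in [set: n.-tuple (h.-tuple bool)])
    (D `&` digits_tuple h @^-1` [set u])).
    by exact: fin_bigcup_measurable.
  apply/seteqP; split=> [x Ax|x [u _ []]//]; by exists (digits_tuple h x).
rewrite (measure_fibers _ mcA).
rewrite (measure_fibers _ (f := @id (n.-tuple (h.-tuple bool))) (D := A));
  last first.
  by move=> u; exact: measurable_stacks.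
apply: eq_bigr => u _; rewrite cA preimage_id setIC; case: ifPn => uA.
  transitivity (lebesgue_product R n (cylinder_tuple R u `&` setT)).
    by rewrite setIT.
  rewrite lebesgue_cylinder_tuple//.
  rewrite preimage_setT setIT lebesgue_cube mule1; congr (stacks_law _ _ _ _).
  by apply/seteqP; split=> [v ->|v []//]; split=> //; exact: set_mem.
rewrite measure0 (_ : _ `&` _ = set0) ?measure0//.
by apply/seteqP; split=> v //= [-> /mem_set]; rewrite (negbTE uA).
Qed.

(** Conditioning on the tails t: the measure of E is the average over t of the
    probability that random stacks u complete t into a point of E, so that a
    bound valid for every single t bounds the measure of E. *)
Lemma lebesgue_le_stacks_law (R : realType) (n h : nat) (V : \bar R)
    (E : set (n.-tuple (measurableTypeR R))) :
  measurable E -> E `<=` cube R n ->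
  (forall t, cube R n t ->
    (stacks_law R n h [set u | E (prepend_tuple u t)] <= V)%E) ->
  (lebesgue_product R n E <= V)%E.
Proof.
move=> mE Ecube EV; have mcube := measurable_cube R n.
have mEu (u : n.-tuple (h.-tuple bool)) :
    measurable (prepend_tuple u @^-1` E : set (n.-tuple (measurableTypeR R))).
  by rewrite -[_ @^-1` _]setTI; exact: measurable_prepend_tuple.
have cE (u : n.-tuple (h.-tuple bool)) :
    E `&` digits_tuple h @^-1` [set u] = cylinder_tuple R u `&` E.
  rewrite cylinder_tupleE setIC -setIA [_ `&` E]setIC setIA.
  by rewrite (setIidr Ecube) setIC.
have mEc (u : n.-tuple (h.-tuple bool)) :
    measurable (E `&` digits_tuple h @^-1` [set u]).
  by rewrite cE; apply: measurableI => //; exact: measurable_cylinder_tuple.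
rewrite (measure_fibers _ mEc).
pose c : R := ((2 ^+ h) ^+ n)^-1.
have c0 : 0 <= c by rewrite invr_ge0 !exprn_ge0.
(* c is the common weight of the families of stacks *)
rewrite (eq_bigr (fun u : n.-tuple (h.-tuple bool) =>
    \int[lebesgue_product R n]_(t in cube R n)
      (c%:E * (\1_(prepend_tuple u @^-1` E) t)%:E))%E); last first.
  move=> u _; rewrite cE.
  apply: etrans (lebesgue_cylinder_tuple u mE) _; rewrite stacks_law_set1.
  rewrite ge0_integralZl//.
  - by rewrite integral_indic ?[_ `&` cube R n]setIC//; exact: mEu.
  - exact/measurable_EFinP/measurable_indic.
rewrite -ge0_integral_sum//; last 2 first.
- move=> u; apply/measurable_EFinP/measurable_funM => //;
  exact: measurable_indic.
- by move=> u t _; rewrite -EFinM lee_fin mulr_ge0.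
rewrite -[leRHS]mule1 -(lebesgue_cube R n) -integral_cst//.
apply: ge0_le_integral => //.
- by move=> t _; apply: sume_ge0 => u _; rewrite -EFinM lee_fin mulr_ge0.
- apply: emeasurable_sum => u.
  by apply/measurable_EFinP/measurable_funM => //; exact: measurable_indic.
move=> t t01; apply: le_trans (EV t t01).
rewrite [leRHS](measure_fibers _ (f := @id (n.-tuple (h.-tuple bool))));
  last first.
  by move=> u; exact: measurable_stacks.
apply: lee_sum => u _; rewrite indicE; have [/set_mem Eu|_] := boolP (t \in _).
  rewrite mule1 -(stacks_law_set1 R u) (_ : _ `&` _ = [set u])//.
  by apply/seteqP; split=> [v []//|v ->].
by rewrite mule0.
Qed.

(** * Lebesgue measurable sets and Borel sets *)

(** Intersect measurable covers of X whose measures are within 1 / (k + 1) of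
    the outer measure. *)
Lemma outer_measure_hull d (T : measurableType d) (R : realType)
    (mu : {measure set T -> \bar R}) (X : set T) :
  ((mu^*)%mu X < +oo)%E ->
  exists H, [/\ measurable H, X `<=` H & mu H = (mu^*)%mu X].
Proof.
move=> Xoo; have Xfin : (mu^*)%mu X \is a fin_num.
  by rewrite ge0_fin_numE//; exact: outer_measure_ge0.
have hull k : exists H, [/\ measurable H, X `<=` H &
    (mu H <= (mu^*)%mu X + (k.+1%:R^-1)%:E)%E].
  have k0 : 0 < k.+1%:R^-1 :> R by rewrite invr_gt0.
  have [_ [F [mF XF] <-] Fle] := lb_ereal_inf_adherent k0 Xfin.
  exists (\bigcup_k F k); split => //; first exact: bigcup_measurable.
  apply: le_trans (ltW Fle); apply: measure_sigma_subadditive => //.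
  exact: bigcup_measurable.
have {hull}[H HP] := choice hull.
have mH : measurable (\bigcap_k H k).
  by apply: bigcap_measurable => // k _; have [] := HP k.
exists (\bigcap_k H k); split => //.
  by move=> x Xx k _; have [_ + _] := HP k; exact.
apply/eqP; rewrite eq_le; apply/andP; split.
  apply/lee_addgt0Pr => e e0.
  have [k _ ke] := near_infty_natSinv_lt (PosNum e0).
  have [mHk _ Hk] := HP k.
  apply: (@le_trans _ _ (mu (H k))).
    by apply: le_measure; rewrite ?inE//; exact: bigcap_inf.
  by apply: (le_trans Hk); rewrite leeD2l// lee_fin ltW// ke/=.
rewrite -(measurable_mu_extE mu mH); apply: le_mu_ext.
by move=> x Xx k _; have [_ + _] := HP k; exact.
Qed.

(** H is a measurable hull of A, and B is the complement in C of a hull of the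
    rest of C. The measurability of A makes the outer measures of A and of the
    rest of C add up to the measure of C, so that B has the outer measure of
    A. *)
Lemma caratheodory_sandwich d (T : measurableType d) (R : realType)
    (mu : {measure set T -> \bar R}) (C A : set T) :
  measurable C -> (mu C < +oo)%E -> A `<=` C ->
  (mu^*)%mu.-cara.-measurable A ->
  exists B H, [/\ measurable B /\ measurable H, B `<=` A /\ A `<=` H,
    mu B = (mu^*)%mu A & mu (H `\` B) = 0%E].
Proof.
move=> mC Coo AC mA.
have fin X : X `<=` C -> ((mu^*)%mu X < +oo)%E.
  move=> XC; apply: le_lt_trans Coo; rewrite -(measurable_mu_extE mu mC).
  exact: le_mu_ext.
have [H [mH AH muH]] := outer_measure_hull (fin _ AC).
have [K [mK CAK muK]] := outer_measure_hull (fin _ (@subDsetl _ C A)).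
have mB : measurable (C `\` K) by exact: measurableD.
have BA : C `\` K `<=` A.
  by move=> x [Cx Kx]; apply: contrapT => Ax; apply: Kx; exact: CAK.
have muB : mu (C `\` K) = (mu^*)%mu A.
  apply/eqP; rewrite eq_le; apply/andP; split.
    by rewrite -(measurable_mu_extE mu mB); exact: le_mu_ext.
  have CE : mu C = ((mu^*)%mu A + mu K)%E.
    by rewrite -(measurable_mu_extE mu mC) (mA C) (setIidr AC) muK setDE.
  have : (mu C <= mu (C `\` K) + mu K)%E.
    apply: le_trans (measureU2 _ mB mK); apply: le_measure; rewrite ?inE//.
      exact: measurableU.
    by move=> x Cx; have [Kx|Kx] := pselect (K x); [right|left].
  rewrite CE leeD2rE// ge0_fin_numE// muK; apply: fin; exact: subDsetl.
exists (C `\` K), H; split => //.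
have Hoo : (mu H < +oo)%E by rewrite muH; exact: fin.
rewrite measureD//= (setIidr (subset_trans BA AH)) muH muB subee//.
rewrite ge0_fin_numE ?fin//.
exact: outer_measure_ge0.
Qed.

(** A strategy is a Lebesgue measurable function of the other coordinates, and
    has to be viewed as a function of all of them. Up to a null set A is a Borel
    set, whose preimage is Borel; null sets have null preimages in the cube by
    lebesgue_drop_coord, and every subset of a null set is measurable. *)
Lemma lebesgue_drop_coord_measurable (R : realType) (n : nat) (i : 'I_n)
    (A : set (lebesgue_space R n.-1)) : A `<=` half_open_cube (m := n.-1) ->
  measurable A ->
  measurable (half_open_cube (m := n) `&` drop_coord i @^-1` A
    : set (lebesgue_space R n)).
Proof.
move=> Acube mA.
have cubeoo : (lebesgue_product R n.-1 (cube R n.-1) < +oo)%E.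
  by rewrite lebesgue_cube ltry.
have [B [H [[mB mH] [BA AH] _ HB]]] :=
  caratheodory_sandwich (measurable_cube R n.-1) cubeoo Acube mA.
pose D X : set (n.-tuple (measurableTypeR R)) :=
  cube R n `&` drop_coord i @^-1` X.
have mD X : measurable X -> measurable (D X).
  move=> mX; apply: measurableI; first exact: measurable_cube.
  by rewrite -[_ @^-1` _]setTI; exact: measurable_drop_coord.
rewrite -[X in measurable X](@setDUK _ (D B : set (lebesgue_space R n))).
  apply: measurableU; first by apply: caratheodory_measurable_mu_ext; exact: mD.
  apply: measure_is_complete_caratheodory; exists (D (H `\` B)); split.
  - by apply: caratheodory_measurable_mu_ext; apply: mD; exact: measurableD.
  - have mHB : measurable (H `\` B) by exact: measurableD.
    apply: etrans (measurable_mu_extE _ (mD _ mHB)) _.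
    apply: etrans (lebesgue_drop_coord i mHB) _.
    apply: subset_measure0 HB => //.
    by apply: measurableI => //; exact: measurable_cube.
  - move=> x [[x01 Ax] DBx]; split=> //.
    by split; [exact: AH|move=> Bx; apply: DBx].
by move=> x [x01 Bx]; split=> //; exact: BA.
Qed.

(** * The payoff is the probability of winning *)

Definition wins (R : realType) (n : nat)
    (k : 'I_n -> lebesgue_space R n.-1 -> nat) : set (lebesgue_space R n) :=
  [set x | forall i, parity_bit (2 ^+ k i (drop_coord i x) * tnth x i) = 1].

Lemma measurable_lebesgue_space (R : realType) (n : nat)
    (A : set (n.-tuple (measurableTypeR R))) :
  measurable A -> measurable (A : set (lebesgue_space R n)).
Proof. exact: caratheodory_measurable_mu_ext. Qed.

Lemma lebesgue_measure_nE (R : realType) (n : nat)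
    (A : set (n.-tuple (measurableTypeR R))) :
  measurable A -> lebesgue_measure_n R n A = lebesgue_product R n A.
Proof. exact: measurable_mu_extE. Qed.

Lemma measurable_half_open_cube (R : realType) (n : nat) :
  measurable (half_open_cube (R := R) (m := n)).
Proof. by apply: measurable_lebesgue_space; exact: measurable_cube. Qed.

Lemma lebesgue_half_open_cube (R : realType) (n : nat) :
  lebesgue_measure_n R n (half_open_cube (m := n)) = 1%E.
Proof.
by rewrite lebesgue_measure_nE ?lebesgue_cube//; exact: measurable_cube.
Qed.

Lemma payoff_integrandE (R : realType) (n : nat)
    (k : 'I_n -> lebesgue_space R n.-1 -> nat) (x : lebesgue_space R n) :
  \prod_(i < n) (parity_bit (2 ^+ k i (drop_coord i x) * tnth x i))%:~R =
  \1_(wins k) x :> R.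
Proof.
rewrite indicE; have [/set_mem xk|/negP xk] := boolP (x \in _).
  by rewrite big1// => i _; rewrite xk.
have [i pi] : exists i, parity_bit (2 ^+ k i (drop_coord i x) * tnth x i) != 1.
  apply: contrapT => nopi; apply: xk; apply: mem_set => i.
  by apply/eqP/negP => pi; apply: nopi; exists i; apply/negP.
by rewrite (bigD1 i)//= parity_bitP (negbTE pi) mul0r.
Qed.

Lemma strategy_event_measurable (R : realType) (n : nat) (i : 'I_n)
    (k : lebesgue_space R n.-1 -> nat) (Y : set nat) :
  lebesgue_strategy k ->
  measurable (half_open_cube (m := n) `&` [set x | Y (k (drop_coord i x))]
    : set (lebesgue_space R n)).
Proof.
move=> [mk _].
have mY : measurable (half_open_cube (m := n.-1) `&` k @^-1` Y).
  by apply: mk => //; exact: measurable_half_open_cube.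
rewrite (_ : _ `&` _ = half_open_cube (m := n) `&` drop_coord i @^-1`
    (half_open_cube (m := n.-1) `&` k @^-1` Y)).
  by apply: lebesgue_drop_coord_measurable => //; exact: subIsetl.
apply/seteqP; split=> x /= [x01]; last by move=> [_ Yx].
by move=> Yx; split=> //; split=> // j; rewrite tnth_mktuple; exact: x01.
Qed.

(** Split according to the choice j + 1 of player i: that this choice is made is
    an event of strategy_event_measurable, and that hat j + 1 is black is an
    event on the first j + 1 digits. *)
Lemma measurable_wins (R : realType) (n : nat)
    (k : 'I_n -> lebesgue_space R n.-1 -> nat) :
  (forall i, lebesgue_strategy (k i)) ->
  measurable (half_open_cube (m := n) `&` wins k).
Proof.
move=> sk.
pose D i j : set (lebesgue_space R n) :=
  (half_open_cube (m := n) `&` [set x | [set j.+1] (k i (drop_coord i x))]) `&`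
  (cube R n `&` digits_tuple j.+1 @^-1`
     [set u | tnth (tnth u i) ord_max = true]).
have mD i j : measurable (D i j).
  apply: measurableI; first exact: strategy_event_measurable.
  by apply: measurable_lebesgue_space; have [] := lebesgue_digits_tuple R
    [set u : n.-tuple (j.+1.-tuple bool) | tnth (tnth u i) ord_max = true].
rewrite (_ : _ `&` _ = half_open_cube (m := n) `&`
    \bigcap_(i in [set: 'I_n]) \bigcup_j D i j); last first.
  apply/seteqP; split=> x /= [x01 xk]; split=> // i.
    have kpos : (0 < k i (drop_coord i x))%N.
      by have [_] := sk i; apply=> j; rewrite tnth_mktuple; exact: x01.
    move=> _; exists (k i (drop_coord i x)).-1 => //; split; split => //=.
      by rewrite prednK.
    rewrite !tnth_mktuple /binary_digit /= prednK//; exact/eqP/xk.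
  have [j _ [[_ /= kj] [_ /=]]] := xk i I.
  by rewrite !tnth_mktuple /binary_digit kj => /eqP.
apply: measurableI; first exact: measurable_half_open_cube.
by apply: fin_bigcap_measurable => // i _; exact: bigcup_measurable.
Qed.

Lemma lebesgue_unit_cube_boundary (R : realType) (n : nat) :
  let boundary : set (lebesgue_space R n) :=
    unit_cube (n := n) `\` half_open_cube (m := n) in
  measurable boundary /\ lebesgue_measure_n R n boundary = 0%E.
Proof.
move=> boundary; pose I := [set t : measurableTypeR R | 0 <= t <= 1].
have IE : I = `[0, 1]%classic by apply/seteqP; split=> t /=; rewrite in_itv.
have mI : measurable I by rewrite IE; exact: measurable_itv.
pose C := [set x : n.-tuple (measurableTypeR R) |
  forall i, (fun=> I) i (tnth x i)].
have mC : measurable C by exact: (measurable_box (A := fun=> I)).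
have C1 : lebesgue_product R n C = 1%E.
  rewrite (tuple_measure_box _ (A := fun=> I))// big1// => i _.
  rewrite IE; apply: etrans (lebesgue_measure_itv _) _.
  by rewrite /= lte_fin ltr01 oppr0 adde0.
have mcube := measurable_cube R n.
have mB : measurable (C `\` cube R n) by exact: measurableD.
split; first exact: measurable_lebesgue_space.
rewrite lebesgue_measure_nE// measureD//=; last by rewrite C1 ltry.
rewrite (setIidr _) ?C1 ?lebesgue_cube ?subee//.
by move=> x x01 i; have /andP[-> /ltW] := x01 i.
Qed.

(** On the boundary of the cube the strategies are arbitrary functions, but the
    boundary is null and the measure complete: winning there is measurable and
    has probability 0. *)
Lemma lebesgue_payoffE (R : realType) (n : nat)
    (k : 'I_n -> lebesgue_space R n.-1 -> nat) :
  (forall i, lebesgue_strategy (k i)) ->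
  lebesgue_payoff k =
  lebesgue_measure_n R n (half_open_cube (m := n) `&` wins k).
Proof.
move=> sk; have mw := measurable_wins sk.
have [mB B0] := lebesgue_unit_cube_boundary R n.
pose B : set (lebesgue_space R n) :=
  unit_cube (n := n) `\` half_open_cube (m := n).
pose C : set (lebesgue_space R n) := half_open_cube (m := n).
have CU : C `<=` unit_cube (n := n).
  by move=> x x01 i; have /andP[-> /ltW] := x01 i.
have mU : measurable (unit_cube (n := n) : set (lebesgue_space R n)).
  rewrite -(setDUK CU); apply: measurableU => //.
  exact: measurable_half_open_cube.
have mwB : measurable (wins k `&` B).
  apply: measure_is_complete_caratheodory; exists B; split=> //.
have -> : lebesgue_payoff k =
    lebesgue_measure_n R n ((C `&` wins k) `|` (wins k `&` B)).
  rewrite -[X in lebesgue_measure_n R n X](setIidl (B := unit_cube (n := n))).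
    rewrite -integral_indic//; last exact: measurableU.
    apply: eq_integral => x /set_mem xU; rewrite payoff_integrandE !indicE.
    suff -> : (x \in (C `&` wins k) `|` (wins k `&` B)) = (x \in wins k) by [].
    apply/idP/idP => /set_mem xk; apply: mem_set; first by case: xk => -[].
    by have [xC|xC] := pselect (C x); [left|right].
  by move=> x [[/CU//]|[_ []]].
have wB0 : lebesgue_measure_n R n (wins k `&` B) = 0%E.
  exact: subset_measure0 B0.
have mCw : measurable (C `&` wins k) by exact: mw.
have CwB : (C `&` wins k) `&` (wins k `&` B) = set0.
  by apply/seteqP; split=> x //= [[Cx _] [_ [_]]].
by apply: etrans (measureU _ mCw mwB CwB) _; rewrite [X in (_ + X)%E]wB0 adde0.
Qed.

(** * Finitely many hats against infinitely many *)

Lemma drop_coord_digits (R : realType) (n h : nat) (i : 'I_n) (x : n.-tuple R) :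
  drop_coord i (digits_tuple h x) = digits_tuple h (drop_coord i x).
Proof. by apply: eq_from_tnth => j; rewrite !tnth_mktuple. Qed.

Lemma drop_coord_prepend (R : realType) (n h : nat) (i : 'I_n)
    (u : n.-tuple (h.-tuple bool)) (t : n.-tuple R) :
  drop_coord i (prepend_tuple u t) =
  prepend_tuple (drop_coord i u) (drop_coord i t).
Proof. by apply: eq_from_tnth => j; rewrite !tnth_mktuple. Qed.

Lemma prepend_tuple_cylinder (R : realType) (n h : nat)
    (u : n.-tuple (h.-tuple bool)) (t : n.-tuple R) :
  cube R n t -> cylinder_tuple R u (prepend_tuple u t).
Proof.
by move=> t01 i; rewrite tnth_mktuple; apply/prepend_cylinderP; exact: t01.
Qed.

(** Let the players apply k to the first h digits of what they see: since these
    digits are distributed like the stacks, the payoff is the probability of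
    winning with k. *)
Lemma stacks_law_all_black_le (R : realType) (n h : nat)
    (k : 'I_n -> hat_strategy n.-1 h) :
  (stacks_law R n h (all_black k) <=
   ereal_sup [set lebesgue_payoff k' |
     k' in [set k' : 'I_n -> lebesgue_space R n.-1 -> nat |
            forall i, lebesgue_strategy (k' i)]])%E.
Proof.
pose k' (i : 'I_n) (y : lebesgue_space R n.-1) : nat :=
  (k i (digits_tuple h (y : n.-1.-tuple R))).+1.
have sk' i : lebesgue_strategy (k' i).
  split=> // _ Y mY.
  have [mD _] := lebesgue_digits_tuple R
    [set v : n.-1.-tuple (h.-tuple bool) | Y (k i v).+1].
  exact: measurable_lebesgue_space mD.
apply: ereal_sup_ubound; exists k' => //.
have [mA lA] := lebesgue_digits_tuple R (all_black k).
rewrite lebesgue_payoffE// -lA -lebesgue_measure_nE//.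
congr (lebesgue_measure_n _ _ _).
apply/seteqP; split=> x /= [x01 xk]; split=> // i.
- by rewrite drop_coord_digits !tnth_mktuple; apply/eqP; exact: xk.
- by have := xk i; rewrite drop_coord_digits !tnth_mktuple => /eqP.
Qed.

Definition late_choice (R : realType) (n : nat)
    (k : 'I_n -> lebesgue_space R n.-1 -> nat) (h : nat) :
    set (lebesgue_space R n) :=
  half_open_cube (m := n) `&` [set x | exists i, (h < k i (drop_coord i x))%N].

Lemma measurable_late_choice (R : realType) (n : nat)
    (k : 'I_n -> lebesgue_space R n.-1 -> nat) (h : nat) :
  (forall i, lebesgue_strategy (k i)) -> measurable (late_choice k h).
Proof.
move=> sk; rewrite (_ : late_choice k h = \bigcup_(i in [set: 'I_n])
  (half_open_cube (m := n) `&`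
    [set x | [set j | (h < j)%N] (k i (drop_coord i x))])).
  by apply: fin_bigcup_measurable => // i _; exact: strategy_event_measurable.
apply/seteqP; split=> x /= [].
  by move=> x01 [i hi]; exists i.
by move=> i _ [x01 hi]; split=> //; exists i.
Qed.

(** For a given point of the cube the n choices are finite, so that these events
    decrease to the empty set. *)
Lemma late_choice_cvg0 (R : realType) (n : nat)
    (k : 'I_n -> lebesgue_space R n.-1 -> nat) :
  (forall i, lebesgue_strategy (k i)) ->
  lebesgue_measure_n R n (late_choice k h) @[h --> \oo] --> 0%E.
Proof.
move=> sk; have mL h := measurable_late_choice h sk.
have L0 : \bigcap_h late_choice k h = set0.
  apply/seteqP; split=> x // xL.
  have [_ [i]] := xL (\max_i k i (drop_coord i x)) I.
  by rewrite ltnNge (leq_bigmax i).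
rewrite -(measure0 (lebesgue_measure_n R n)) -L0.
apply: nonincreasing_cvg_mu => //.
- apply: le_lt_trans (ltry 1); rewrite -(lebesgue_half_open_cube R n).
  apply: le_measure; rewrite ?inE//; first exact: measurable_half_open_cube.
  exact: subIsetl.
- exact: bigcap_measurable.
- move=> h h' hh'; apply/subsetPset => x [x01 [i hi]]; split=> //; exists i.
  exact: leq_ltn_trans hh' hi.
Qed.

(** Fix the tails t of all the coordinates after the first h + 1 digits. What
    the strategies k do is then a function of those digits only, hence a
    strategy kt for h + 1 hats, provided that no choice exceeds h + 1. So for
    every t the probability of winning without a late choice is at most the
    value of the game with h + 1 hats, and lebesgue_le_stacks_law applies. It
    needs a Borel event, taken from caratheodory_sandwich. *)
Lemma lebesgue_payoff_le_hat_value (R : realType) (n h : nat)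
    (k : 'I_n -> lebesgue_space R n.-1 -> nat) :
  (forall i, lebesgue_strategy (k i)) ->
  (lebesgue_payoff k <= hat_value_h R n h.+1 +
    lebesgue_measure_n R n (late_choice k h.+1))%E.
Proof.
move=> sk; rewrite lebesgue_payoffE//.
pose L := late_choice k h.+1.
pose C : set (lebesgue_space R n) := half_open_cube (m := n).
have mL : measurable L by exact: measurable_late_choice.
have mW : measurable ((C `&` wins k) `\` L).
  by apply: measurableD => //; exact: measurable_wins.
have Coo : (lebesgue_product R n (cube R n) < +oo)%E.
  by rewrite lebesgue_cube ltry.
have WC : (C `&` wins k) `\` L `<=` C by move=> x [[]].
have [B [_ [[mB _] [BW _] muB _]]] :=
  caratheodory_sandwich (measurable_cube R n) Coo WC mW.
apply: (@le_trans _ _ (lebesgue_measure_n R n ((C `&` wins k) `\` L) +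
    lebesgue_measure_n R n L)%E).
  apply: le_trans (measureU2 _ mW mL); apply: le_measure; rewrite ?inE//.
  - exact: measurable_wins.
  - exact: measurableU.
  - by move=> x Wx; have [Lx|Lx] := pselect (L x); [right|left].
apply: leeD2r; rewrite -[leLHS]muB.
apply: (lebesgue_le_stacks_law (h := h.+1)) => // [x /BW/WC//|t t01].
(* Choices start at 1 and hats at 0, whence the predecessor; inord sends the
   choices that are too large, excluded on B, to a default hat. *)
pose kt i (v : n.-1.-tuple (h.+1.-tuple bool)) : 'I_h.+1 :=
  inord (k i (prepend_tuple v (drop_coord i t))).-1.
apply: le_trans (_ : stacks_law R n h.+1 (all_black kt) <= _)%E; last first.
  by apply: ereal_sup_ubound; exists kt.
apply: le_measure; rewrite ?inE; [exact: measurable_stacks..|].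
move=> u /= /BW [[x01 xk] xL] i; have := xk i.
set x := prepend_tuple u t in x01 xk xL *.
have xdrop : drop_coord i x = prepend_tuple (drop_coord i u) (drop_coord i t).
  exact: drop_coord_prepend.
have kpos : (0 < k i (drop_coord i x))%N.
  by have [_] := sk i; apply=> j; rewrite tnth_mktuple; exact: x01.
have kle : (k i (drop_coord i x) <= h.+1)%N.
  by rewrite leqNgt; apply/negP => hk; apply: xL; split=> //; exists i.
have [_ <-] := prepend_tuple_cylinder u t01 i.
rewrite -/x /kt -xdrop [tnth (digits _ _) _]tnth_mktuple inordK ?prednK//.
rewrite /binary_digit prednK//.
by move=> ->.
Qed.

Theorem theorem10 (R : realType) (n : nat) (n_ge1 : (1 <= n)%N) :
  hat_value R n =
  ereal_sup [set lebesgue_payoff k |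
             k in [set k : 'I_n -> lebesgue_space R n.-1 -> nat |
                   forall i, lebesgue_strategy (k i)]].
Proof.
set S := ereal_sup _.
have Vle h : (hat_value_h R n h <= S)%E.
  by apply: ge_ereal_sup => _ [k _ <-]; exact: stacks_law_all_black_le.
have payoff_le1 (k : 'I_n -> lebesgue_space R n.-1 -> nat) :
    (forall i, lebesgue_strategy (k i)) -> (lebesgue_payoff k <= 1)%E.
  move=> sk; rewrite lebesgue_payoffE// -(lebesgue_half_open_cube R n).
  apply: le_measure; rewrite ?inE; last exact: subIsetl.
    exact: measurable_wins.
  exact: measurable_half_open_cube.
have V0 h : (0 <= hat_value_h R n h.+1)%E.
  apply: le_trans (ereal_sup_ubound _); last by exists (fun _ _ => ord0).
  exact: measure_ge0.
have Sfin : S \is a fin_num.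
  rewrite ge0_fin_numE; last exact: le_trans (V0 0%N) (Vle _).
  apply: le_lt_trans (ltry 1); apply: ge_ereal_sup => _ [k sk <-].
  exact: payoff_le1.
have Vfin h : hat_value_h R n h.+1 \is a fin_num.
  rewrite ge0_fin_numE//; apply: le_lt_trans (Vle _) _.
  by rewrite -ge0_fin_numE// (le_trans (V0 0%N) (Vle _)).
(* Without hats there is no strategy and the value is -oo: only the values
   for h + 1 hats are finite. *)
apply/cvg_lim => //; rewrite -cvg_shiftS /=.
suff : hat_value_h R n h.+1 @[h --> \oo] --> (fine S)%:E by rewrite fineK.
apply/fine_cvgP; split; first by exists 0%N.
apply/cvgrPdist_le => e e0.
have e20 : 0 < e / 2 by rewrite divr_gt0.
have [_ [k sk <-] Sk] := ub_ereal_sup_adherent e20 Sfin.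
have [N _ LN] : \forall h \near \oo,
    (lebesgue_measure_n R n (late_choice k h) < (e / 2)%:E)%E.
  have /fine_cvgP[Lfin Llim] := late_choice_cvg0 sk.
  near=> h; have Lh : lebesgue_measure_n R n (late_choice k h) \is a fin_num.
    by near: h.
  rewrite -(fineK Lh) lte_fin; near: h.
  by apply: (cvgr_lt 0) => //.
exists N => // h /= Nh.
have SV : (S - (e / 2)%:E < hat_value_h R n h.+1 + (e / 2)%:E)%E.
  apply: lt_le_trans Sk _.
  apply: le_trans (lebesgue_payoff_le_hat_value h sk) _.
  by rewrite leeD2l// ltW// LN//= leqW.
move: SV (Vle h.+1); rewrite -(fineK Sfin) -(fineK (Vfin h)).
rewrite -EFinB -EFinD lte_fin lee_fin /= => SV VS.
by rewrite ger0_norm ?subr_ge0//; lra.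
Unshelve. all: by end_near.
Qed.
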